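(* Let $(\Omega,\mathcal{F},\mathbf{P})$ be a probability space. (1) If $(X_t,\mathcal{F}_t)$ is a test supermartingale, then $1/X^*_\infty$ is a $p$-test. (2) If $p$ is a precise $p$-test, then there is a test martingale $(X_t)$ such that $p=1/X^*_\infty$.
   Context: Conventions: $1/0=\infty$, $1/\infty=0$. Random variables may take the values $\pm\infty$. Time: the index $t$ ranges over $\{0,1,2,\ldots\}$ (discrete time) or $[0,\infty)$ (continuous time); when the existence of a test martingale is asserted without a given time scale, its time set may be either of these. A filtration $(\mathcal{F}_t)$ is an indexed family of sub-$\sigma$-algebras of $\mathcal{F}$ with $\mathcal{F}_s\subseteq\mathcal{F}_t$ for $s<t$. $(X_t,\mathcal{F}_t)$ is a supermartingale if $(\mathcal{F}_t)$ is a filtration, each $X_t$ is $\mathcal{F}_t$-measurable and integrable, and $\mathbf{E}(X_t\mid\mathcal{F}_s)\le X_s$ a.s. for all $s<t$; it is a martingale if equality holds a.s. for all $s<t$. A process $(X_t)$ written without a filtration is called a (super)martingale if it is one with respect to the filtration it generates, $\mathcal{F}_t=\sigma(X_s: s\le t)$. In continuous time it is always assumed that the paths of $(X_t)$ are right-continuous almost surely, and that the filtration $(\mathcal{F}_t)$ in $(X_t,\mathcal{F}_t)$ satisfies the usual conditions: each $\mathcal{F}_t$ contains all subsets of every $E\in\mathcal{F}$ with $\mathbf{P}(E)=0$, and $\mathcal{F}_t=\bigcap_{s>t}\mathcal{F}_s$. (When a continuous-time process is given without a filtration, its generated filtration need not satisfy the usual conditions; one may then complete the space and replace the filtration by its usual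 augmentation, which preserves the (super)martingale property.) A test supermartingale is a supermartingale with $X_t\ge 0$ for all $t$ and $\mathbf{E}(X_0)\le 1$. A test martingale is a martingale with $X_t\ge0$ for all $t$ and $\mathbf{E}(X_0)=1$. By convention $X_t:=1$ for $t<0$, and $X^*_\infty:=\sup_s X_s$ includes these times; thus $X^*_\infty=\max(1,\sup_{s\ge0}X_s)\ge1$. A $p$-test is a measurable function $p:\Omega\to[0,1]$ such that $\mathbf{P}\{\omega: p(\omega)\le\delta\}\le\delta$ for all $\delta\in[0,1]$; it is precise if $\mathbf{P}\{\omega: p(\omega)\le\delta\}=\delta$ for all $\delta\in[0,1]$. *)

(* Defs.v *)
From HB Require Import structures.
From mathcomp Require Import all_boot all_order all_algebra.
From mathcomp Require Import all_classical all_reals all_analysis.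
From mathcomp Require Import measurable_realfun.
Import Order.TTheory GRing.Theory Num.Theory.
Import numFieldNormedType.Exports.

Set Implicit Arguments.
Unset Strict Implicit.
Unset Printing Implicit Defensive.

Local Open Scope classical_set_scope.
Local Open Scope ring_scope.
Local Open Scope ereal_scope.

Definition sub_sigma_algebra d (T : measurableType d) (G : set (set T)) :=
  sigma_algebra [set: T] G /\ G `<=` measurable.

Definition measurable_wrt (R : realType) (T : Type)
    (G : set (set T)) (Y : T -> \bar R) :=
  preimage_set_system [set: T] Y measurable `<=` G.

(* Y is a version of the conditional expectation E(X | G). *)
Definition is_cond_expectation d (T : measurableType d) (R : realType)
    (P : probability T R) (G : set (set T)) (X Y : T -> \bar R) :=
  [/\ measurable_wrt G Y,
      P.-integrable [set: T] Y &
      forall A, G A -> \int[P]_(w in A) Y w = \int[P]_(w in A) X w].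

(* Processes and filtrations are functions on an ordered type I, of which only
   the values at times t >= t0 matter: the two cases of interest are I = nat
   with t0 = 0 (discrete time) and I = R with t0 = 0 (continuous time, the
   time set being [0, +oo[). *)
Section processes.
Context (dI : Order.disp_t) (I : porderType dI) (t0 : I).
Context d (T : measurableType d) (R : realType) (P : probability T R).
Implicit Types (X : I -> T -> \bar R) (F : I -> set (set T)).

Definition is_filtration F :=
  (forall t, (t0 <= t)%O -> sub_sigma_algebra (F t)) /\
  (forall s t, (t0 <= s)%O -> (s < t)%O -> F s `<=` F t).

Definition adapted_integrable X F :=
  forall t, (t0 <= t)%O ->
    measurable_wrt (F t) (X t) /\ P.-integrable [set: T] (X t).

Definition supermartingale X F :=
  [/\ is_filtration F, adapted_integrable X F &
      forall s t, (t0 <= s)%O -> (s < t)%O ->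
        exists2 Y, is_cond_expectation P (F s) (X t) Y &
                   {ae P, forall w, Y w <= X s w}].

Definition martingale X F :=
  [/\ is_filtration F, adapted_integrable X F &
      forall s t, (t0 <= s)%O -> (s < t)%O ->
        exists2 Y, is_cond_expectation P (F s) (X t) Y &
                   {ae P, forall w, Y w = X s w}].

Definition natural_filtration X (t : I) : set (set T) :=
  <<s \bigcup_(s in [set s | (t0 <= s <= t)%O])
        preimage_set_system [set: T] (X s) measurable >>.

Definition nonneg_process X :=
  forall t, (t0 <= t)%O -> forall w, 0 <= X t w.

(* The supremum includes the times before t0, at which X is 1 by convention. *)
Definition process_sup X (w : T) : \bar R :=
  maxe 1 (ereal_sup [set X t w | t in [set t | (t0 <= t)%O]]).

End processes.

Section test_martingales.
Context d (T : measurableType d) (R : realType) (P : probability T R).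

Definition right_continuous_paths (X : R -> T -> \bar R) :=
  {ae P, forall w, forall t, (0 <= t)%R -> X^~ w @ t^'+ --> X t w}.

Definition usual_conditions (F : R -> set (set T)) :=
  forall t, (0 <= t)%R ->
    (forall N, P.-negligible N -> F t N) /\
    F t = \bigcap_(s in [set s | (t < s)%R]) F s.

Definition test_supermartingale_discrete
    (X : nat -> T -> \bar R) (F : nat -> set (set T)) :=
  [/\ supermartingale 0%N P X F, nonneg_process 0%N X &
      \int[P]_w X 0%N w <= 1].

Definition test_supermartingale_continuous
    (X : R -> T -> \bar R) (F : R -> set (set T)) :=
  [/\ usual_conditions F, right_continuous_paths X,
      supermartingale 0%R P X F, nonneg_process 0%R X &
      \int[P]_w X 0%R w <= 1].

(* Here no filtration is given, so the generated one is used; in continuous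
   time it is not required to satisfy the usual conditions. *)
Definition test_martingale_discrete (X : nat -> T -> \bar R) :=
  [/\ martingale 0%N P X (natural_filtration 0%N X), nonneg_process 0%N X &
      \int[P]_w X 0%N w = 1].

Definition test_martingale_continuous (X : R -> T -> \bar R) :=
  [/\ right_continuous_paths X,
      martingale 0%R P X (natural_filtration 0%R X), nonneg_process 0%R X &
      \int[P]_w X 0%R w = 1].

Definition p_test (p : T -> \bar R) :=
  [/\ measurable_fun [set: T] p,
      forall w, 0 <= p w <= 1 &
      forall delta : R, (0 <= delta <= 1)%R ->
        P [set w | p w <= delta%:E] <= delta%:E].

Definition precise_p_test (p : T -> \bar R) :=
  p_test p /\
  forall delta : R, (0 <= delta <= 1)%R ->
    P [set w | p w <= delta%:E] = delta%:E.

End test_martingales.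

(* Main.v *)
Require Import Defs.
From HB Require Import structures.
From mathcomp Require Import all_boot all_order all_algebra.
From mathcomp Require Import all_classical all_reals all_analysis.
From mathcomp Require Import measurable_realfun.
Import Order.TTheory GRing.Theory Num.Theory.
Import numFieldNormedType.Exports.

Local Open Scope classical_set_scope.
Local Open Scope ring_scope.
Local Open Scope ereal_scope.

(** (1) The probability that a nonnegative supermartingale with initial mean at
most 1 ever reaches the level a is at most 1/a: betting on it, and stopping when
it reaches a, secures a payoff a on that event without raising the mean.  In
discrete time this is [discrete_maximal_inequality].  Letting the horizon grow
bounds P (X^* > a), with a strict inequality, by 1/a
([discrete_process_sup_tail]).  Since 1 / X^* <= delta implies
X^* > 1 / (delta + e) for every e > 0, such tail bounds are all that is needed
for 1 / X^* to be a p-test ([p_test_inve]).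

In continuous time, the process sampled along a dyadic grid of step 2^-n is a
discrete test supermartingale.  On almost every path, if the supremum over all
times exceeds a, then by right-continuity so does the supremum over one of these
grids ([process_sup_continuous_gt]).  The grids are nested, so the tail bound
passes to the limit.  On the null set of the other paths the
supremum is arbitrary, and it is measurable there because the usual conditions
make the probability space complete.

(2) A precise p-test p is uniformly distributed.  In continuous time, let the
wealth at time t be 1 + t as long as p < 1 / (1 + t) and 0 afterwards.  Its mean
is (1 + t) * P (p < 1 / (1 + t)) = 1, and its supremum is 1 / p.  All that its
past up to time s can reveal on the event p < 1 / (1 + s) is that this event
occurs: an event of the natural filtration at time s contains it or misses it
([alive_atom]).  As the wealth after s vanishes off that event, the martingale
property reduces to the constancy of the mean ([wealth_conserved]). *)

Set Implicit Arguments.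
Unset Strict Implicit.
Unset Printing Implicit Defensive.

(** * From tail bounds to p-tests *)

Section tail_bounds.
Context d (T : measurableType d) (R : realType) (P : probability T R).

Lemma measurable_fun_gt (S : T -> \bar R) :
  (forall a : R, measurable [set w | a%:E < S w]) ->
  measurable_fun [set: T] S.
Proof.
move=> mS; apply: (measurability _ (ErealGenOInfty.measurableE R)).
by move=> _ [_ [a ->] <-]; rewrite setTI preimage_itvoy.
Qed.

Lemma nondecreasing_measure_bigcup_le (B : (set T)^nat) (c : \bar R) :
  (forall n, measurable (B n)) -> nondecreasing_seq B ->
  (forall n, P (B n) <= c) -> P (\bigcup_n B n) <= c.
Proof.
move=> mB ndB Bc.
have cB : P (B n) @[n --> \oo] --> P (\bigcup_n B n).
  by apply: nondecreasing_cvg_mu => //; exact: bigcup_measurable.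
rewrite -(cvg_lim _ cB)//; apply: lime_le; first exact: cvgP cB.
exact: nearW.
Qed.

(** Strict tail bounds suffice although the event S^-1 <= delta is closed: it is
contained in the event S > 1 / (delta + e) for every e > 0, and e tends to 0. *)
Lemma p_test_inve (S : T -> \bar R) :
  (forall w, 1 <= S w) -> measurable_fun [set: T] S ->
  (forall a : R, (1 <= a)%R -> P [set w | a%:E < S w] <= (a^-1)%:E) ->
  p_test P (fun w => 1 / S w).
Proof.
move=> S1 mS PS.
have S0 w : 0 <= S w by rewrite (le_trans _ (S1 w)).
have mV : measurable_fun [set: T] (fun w => 1 / S w).
  apply: measurable_fun_gt => a; under eq_set do rewrite mul1e.
  have [a0|a0] := ltP a 0%R.
    rewrite (_ : [set _ | _] = setT)//; apply/seteqP; split => // w _ /=.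
    by rewrite (@lt_le_trans _ _ 0)// ?lte_fin// inve_ge0.
  under eq_set do rewrite inve_pgt ?inE ?lee_fin//.
  rewrite -[X in measurable X]setTI.
  exact: emeasurable_fun_infty_o.
split => // [w|delta /andP[d0 d1]].
  by rewrite mul1e inve_ge0 S0/= -inve_ge1 ?inve_ge0// inveK S1.
apply/lee_addgt0Pr => e e0; rewrite -EFinD.
have mD : measurable [set w | 1 / S w <= delta%:E].
  by rewrite -[X in measurable X]setTI; exact: emeasurable_fun_infty_c.
have [de1|de1] := leP (delta + e)%R 1%R; last first.
  by rewrite (le_trans (probability_le1 P mD))// lee_fin ltW.
have de0 : (0 < delta + e)%R by rewrite ltr_wpDl.
rewrite -[leRHS]/((delta + e)%:E) -[(delta + e)%R]invrK.
apply: le_trans (PS (delta + e)^-1%R _); last by rewrite invf_ge1.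
apply: le_measure; rewrite ?inE//.
  by rewrite -[X in measurable X]setTI; exact: emeasurable_fun_o_infty.
move=> w /=; rewrite mul1e => Sd.
have -> : ((delta + e)^-1)%:E = (delta + e)%:E^-1 by rewrite inver gt_eqF.
rewrite inve_plt ?inE ?lee_fin ?(ltW de0)//.
by rewrite (le_lt_trans Sd)// lte_fin ltrDl.
Qed.

Lemma process_sup_ge1 dI (I : porderType dI) (t0 : I) (X : I -> T -> \bar R) w :
  1 <= process_sup t0 X w.
Proof. by rewrite /process_sup le_max lexx. Qed.

Lemma process_sup_ge dI (I : porderType dI) (t0 : I) (X : I -> T -> \bar R) t w :
  (t0 <= t)%O -> X t w <= process_sup t0 X w.
Proof.
by move=> tt; rewrite le_max; apply/orP; right; apply: ereal_sup_ubound; exists t.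
Qed.

Lemma process_sup_gt dI (I : porderType dI) (t0 : I) (X : I -> T -> \bar R)
    (a : \bar R) w :
  a < process_sup t0 X w ->
  a < 1 \/ exists2 t, (t0 <= t)%O & a < X t w.
Proof.
rewrite /process_sup lt_max => /orP[|/ereal_sup_gt[_ [t tt <-] aX]]; first by left.
by right; exists t.
Qed.

(** * The maximal inequality in discrete time *)

(** The version Y of the conditional expectation need not be nonnegative, but it
is dominated by X s, so that its positive part is as well. *)
Lemma supermartingale_integral_le dI (I : porderType dI) (t0 : I)
    (X : I -> T -> \bar R) F s t A :
  supermartingale t0 P X F -> nonneg_process t0 X ->
  (t0 <= s)%O -> (s < t)%O -> F s A ->
  \int[P]_(w in A) X t w <= \int[P]_(w in A) X s w.
Proof.
move=> [[sF _] aX sX] X0 ts st FA.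
have [Y [_ iY AY] YX] := sX _ _ ts st.
have mA : measurable A by apply: (sF _ ts).2.
have mY : measurable_fun A Y by apply: measurable_funTS; exact: measurable_int iY.
rewrite -(AY _ FA) integralE.
apply: (@le_trans _ _ (\int[P]_(w in A) (Y^\+ w))).
  by rewrite geeDl// oppe_le0; exact: integral_ge0.
apply: ae_ge0_le_integral => //.
- exact: measurable_funepos.
- by move=> w _; exact: X0.
- by apply: measurable_funTS; exact: measurable_int (aX _ ts).2.
- apply: filterS YX => w YX _.
  by rewrite funeposE ge_max YX X0.
Qed.

(** Let A k be the event that X stays below a before time k.  The quantity
a * P (~ A k) + E (X k; A k) is the mean of the process stopped on reaching a,
with the stopped value lowered to a; it starts from E (X 0) and cannot increase,
since A k.+1 belongs to F k. *)
Lemma discrete_maximal_inequality X F (a : R) n :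
  test_supermartingale_discrete P X F -> (0 < a)%R ->
  P [set w | exists2 k, (k < n)%N & a%:E <= X k w] <= (a^-1)%:E.
Proof.
move=> [sX X0 EX] a0.
have [[sF FF] aX _] := sX.
have mX k : measurable_fun [set: T] (X k) by exact: measurable_int (aX k _).2.
pose A n := [set w | forall k, (k < n)%N -> X k w < a%:E].
have mX_lt k : F k [set w | X k w < a%:E].
  apply: (aX k _).1 => //; exists `]-oo, a%:E[%classic; first exact: emeasurable_itv.
  by rewrite setTI preimage_itvNyo.
have AS k : A k.+1 = A k `&` [set w | X k w < a%:E].
  apply/seteqP; split => [w Aw|w [Aw Xw] j].
    by split => [j jk|]; apply: Aw => //; rewrite ltnS ltnW.
  by rewrite ltnS leq_eqVlt => /orP[/eqP ->//|/Aw].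
have setI_F k B C : F k B -> F k C -> F k (B `&` C).
  move=> FB FC; have [[F0 FD FU] _] := sF k isT.
  (* Closure under finite intersections, as sigma-algebras are presented by
     complements and countable unions. *)
  have -> : B `&` C = setT `\` ((setT `\` B) `|` (setT `\` C)).
    by rewrite !setTD setCU !setCK.
  by rewrite -bigcup2E; apply: (FD); apply: FU => -[|[|i]]/=; [exact: FD|exact: FD|].
have FA k : F k (A k.+1).
  elim: k => [|k IH]; rewrite AS.
    apply: setI_F => //; rewrite (_ : A 0%N = setT); last first.
      by apply/seteqP; split.
    by have [[F0 FD _] _] := sF 0%N isT; rewrite -(setD0 setT); exact: FD.
  by apply: setI_F => //; apply: FF IH => //; rewrite ltEnat/=.
have mA k : measurable (A k).
  case: k => [|k]; last exact: (sF k isT).2 (FA k).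
  by rewrite (_ : A 0%N = setT)//; apply/seteqP; split.
suff H k : a%:E * P (~` A k) + \int[P]_(w in A k) X k w <= 1.
  rewrite (_ : [set _ | _] = ~` A n); last first.
    apply/seteqP; split => [w [k kn aX'] /(_ _ kn)|w].
      by rewrite ltNge aX'.
    move=> /existsNP[k]/not_implyP[kn /negP].
    by rewrite -leNgt => ?; exists k.
  rewrite -(@lee_pmul2l _ a%:E)// -EFinM divff ?gt_eqF//.
  apply: le_trans (H n); rewrite leeDl//; apply: integral_ge0 => w _.
  exact: X0.
elim: k => [|k IH].
  rewrite (_ : A 0%N = setT); last by apply/seteqP; split.
  by rewrite setCT measure0 mule0 add0e.
apply: le_trans IH.
(* E is the event that a is first reached at time k. *)
pose E := A k `&` [set w | a%:E <= X k w].
have mE : measurable E.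
  apply: measurableI => //; rewrite -[X in measurable X]setTI.
  exact: emeasurable_fun_c_infty.
have AE : A k = E `|` A k.+1.
  apply/seteqP; split => [w Aw|w [[]//|]]; last by rewrite AS => -[].
  by have [aX'|Xa] := leP a%:E (X k w); [left|right; rewrite AS].
have EA : [disjoint E & A k.+1].
  apply/disj_setPS => w [[_ /= aX'] /(_ k (ltnSn k))].
  by rewrite ltNge aX'.
have CE : ~` A k.+1 = ~` A k `|` E.
  rewrite AE setCU setUIl setvU setTI; apply/esym/setUidPl => w Ew.
  by move/disj_setPS : EA => /(_ w) EA Aw; apply: EA.
have mAC : measurable (~` A k) by exact: measurableC.
rewrite CE measureU//; last first.
  by apply/seteqP; split => // w [+ []].
rewrite muleDr ?fin_num_adde_defl ?fin_num_measure//.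
rewrite -addeA leeD2l// [X in _ <= \int[P]_(w in X) _]AE.
rewrite ge0_integral_setU//; first last.
- by move=> w _; exact: X0.
- exact: measurable_funTS.
apply: leeD; last first.
  by apply: (supermartingale_integral_le sX X0 _ _ (FA k)) => //; rewrite ltEnat/=.
rewrite -integral_cst//; apply: ge0_le_integral => //.
- by move=> w _; rewrite lee_fin ltW.
- exact: measurable_funTS.
- by move=> w [].
Qed.

Lemma measurable_process_sup_discrete (X : nat -> T -> \bar R) :
  (forall n, measurable_fun [set: T] (X n)) ->
  measurable_fun [set: T] (process_sup 0%N X).
Proof.
move=> mX; apply: measurable_fun_gt => a.
have [a1|a1] := ltP a 1%R.
  rewrite (_ : [set _ | _] = setT)//; apply/seteqP; split => // w _ /=.
  by rewrite (lt_le_trans _ (process_sup_ge1 _ _ _))// lte_fin.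
rewrite (_ : [set _ | _] = \bigcup_n [set w | a%:E < X n w]).
  apply: bigcup_measurable => n _; rewrite -[X in measurable X]setTI.
  exact: emeasurable_fun_o_infty.
apply/seteqP; split => w /=.
  by case/process_sup_gt => [|[n _]]; [rewrite lte_fin ltNge a1|exists n].
by move=> [n _ /= aX]; rewrite (lt_le_trans aX)//; exact: process_sup_ge.
Qed.

Lemma discrete_process_sup_tail X F (a : R) :
  test_supermartingale_discrete P X F -> (1 <= a)%R ->
  P [set w | a%:E < process_sup 0%N X w] <= (a^-1)%:E.
Proof.
move=> tX a1; have [[_ aX _] _ _] := tX.
have mX k : measurable_fun [set: T] (X k) by exact: measurable_int (aX k _).2.
pose B n := [set w | exists2 k, (k < n)%N & a%:E <= X k w].
have mB n : measurable (B n).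
  rewrite (_ : B n = \bigcup_(k in `I_n) [set w | a%:E <= X k w]).
    apply: bigcup_measurable => k _; rewrite -[X in measurable X]setTI.
    exact: emeasurable_fun_c_infty.
  by apply/seteqP; split => w [k]; exists k.
have ndB : nondecreasing_seq B.
  move=> m n mn; apply/subsetPset => w [k km aXk].
  by exists k => //; exact: leq_trans mn.
apply: (@le_trans _ _ (P (\bigcup_n B n))); last first.
  apply: nondecreasing_measure_bigcup_le => // n.
  by apply: discrete_maximal_inequality tX _; rewrite (lt_le_trans _ a1).
apply: le_measure; rewrite ?inE.
- rewrite -[X in measurable X]setTI; apply: emeasurable_fun_o_infty => //.
  exact: measurable_process_sup_discrete.
- exact: bigcup_measurable.
move=> w /= /process_sup_gt[|[k _ aXk]]; first by rewrite lte_fin ltNge a1.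
by exists k.+1 => //; exists k => //; exact: ltW.
Qed.

Lemma p_test_discrete X F : test_supermartingale_discrete P X F ->
  p_test P (fun w => 1 / process_sup 0%N X w).
Proof.
move=> tX; have [[_ aX _] _ _] := tX.
apply: p_test_inve => [w||a]; first exact: process_sup_ge1.
- apply: measurable_process_sup_discrete => n.
  exact: measurable_int (aX n _).2.
- exact: discrete_process_sup_tail tX.
Qed.

(** * Continuous time: sampling along dyadic grids *)

Lemma test_supermartingale_sample (X : R -> T -> \bar R) F (g : nat -> R) :
  test_supermartingale_continuous P X F ->
  g 0%N = 0%R -> {homo g : m n / (m < n)%N >-> (m < n)%R} ->
  test_supermartingale_discrete P (X \o g) (F \o g).
Proof.
move=> [_ _ [[sF FF] aX sX] X0 EX] g0 gmono.
have g_ge0 n : (0 <= g n)%R.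
  by case: n => [|n]; rewrite ?g0// -g0 ltW// gmono.
split => /=.
- split.
  + by split => [t _|s t _ st]; [exact: sF|apply: FF => //; exact: gmono].
  + by move=> t _; exact: aX.
  + by move=> s t _ st; apply: sX => //; exact: gmono.
- by move=> t _ w; exact: X0.
- by rewrite g0.
Qed.

Definition dyadic (n k : nat) : R := k%:R / 2 ^+ n.

Lemma dyadic_right_dense (t e : R) : (0 <= t)%R -> (0 < e)%R ->
  exists n k, (t < dyadic n k < t + e)%R.
Proof.
move=> t0 e0; pose n := (Num.trunc e^-1).+1; exists n.
have p0 : (0 < 2 ^+ n :> R)%R by rewrite exprn_gt0.
have ei : (0 <= e^-1)%R by rewrite invr_ge0 ltW.
have e2n : ((2 ^+ n)^-1 < e)%R.
  rewrite invf_plt ?posrE//.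
  have /andP[_ /lt_le_trans] := truncn_itv ei; apply.
  by rewrite -natrX ler_nat ltnW// ltn_expl.
have tn0 : (0 <= t * 2 ^+ n)%R by rewrite mulr_ge0// ltW.
have /andP[ht1 ht2] := truncn_itv tn0.
exists (Num.trunc (t * 2 ^+ n)%R).+1; rewrite /dyadic.
rewrite ltr_pdivlMr// ht2/= ltr_pdivrMr// -natr1 mulrDl ler_ltD//.
by rewrite -ltr_pdivrMr// mul1r.
Qed.

Lemma process_sup_continuous_gt (X : R -> T -> \bar R) (a : R) w :
  (forall t, (0 <= t)%R -> X^~ w @ t^'+ --> X t w) ->
  a%:E < process_sup 0%R X w ->
  exists n, a%:E < process_sup 0%N (X \o dyadic n) w.
Proof.
move=> rcX /process_sup_gt[a1|[t t0 aX]].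
  by exists 0%N; rewrite (lt_le_trans a1)// process_sup_ge1.
have Xta : nbhs (X t w) [set y | a%:E < y].
  by apply: open_nbhs_nbhs; split; [exact: open_ereal_gt_ereal|].
have /nbhs_ballP[e /= e0 He] := rcX t t0 _ Xta.
have [n [k /andP[tk ke]]] := dyadic_right_dense t0 e0.
exists n; have := @process_sup_ge _ _ 0%N (X \o dyadic n) k w isT.
apply: lt_le_trans; apply: He => //=.
by rewrite /ball/= distrC ger0_norm ?subr_ge0 ?ltW// ltrBlDl.
Qed.

(** The dyadic grids are nested, which is what makes the suprema along them
comparable. *)
Lemma dyadic_process_sup_nondecreasing (X : R -> T -> \bar R) w m n :
  (m <= n)%N ->
  process_sup 0%N (X \o dyadic m) w <= process_sup 0%N (X \o dyadic n) w.
Proof.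
move=> mn; rewrite {1}/process_sup ge_max process_sup_ge1/=.
apply: ge_ereal_sup => _ [k _ <-] /=.
have -> : dyadic m k = dyadic n (k * 2 ^ (n - m)).
  rewrite /dyadic -{2}(subnK mn) exprD natrM natrX invfM mulrA mulfK//.
exact: (@process_sup_ge _ _ 0%N (X \o dyadic n)).
Qed.

Lemma process_sup_ge_dyadic (X : R -> T -> \bar R) n w :
  process_sup 0%N (X \o dyadic n) w <= process_sup 0%R X w.
Proof.
rewrite {1}/process_sup ge_max process_sup_ge1/=.
apply: ge_ereal_sup => _ [k _ <-] /=; apply: process_sup_ge.
by rewrite /dyadic divr_ge0// exprn_ge0.
Qed.

(** Off a null set N of irregular paths the supremum is the increasing limit of
the suprema along the dyadic grids; the part of any event inside N is negligible, hence
measurable by the usual conditions, and does not change probabilities. *)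
Lemma p_test_continuous X F : test_supermartingale_continuous P X F ->
  p_test P (fun w => 1 / process_sup 0%R X w).
Proof.
move=> tX; have [uF rcX [[sF _] _ _] _ _] := tX.
have tXn n : test_supermartingale_discrete P (X \o dyadic n) (F \o dyadic n).
  apply: test_supermartingale_sample tX _ _; first by rewrite /dyadic mul0r.
  by move=> i j ij; rewrite /dyadic ltr_pM2r ?ltr_nat// invr_gt0 exprn_gt0.
have complete N : P.-negligible N -> measurable N.
  by move=> /((uF 0%R (lexx _)).1); exact: (sF 0%R (lexx _)).2.
have [N [mN PN NX]] := rcX.
pose B (a : R) n := [set w | a%:E < process_sup 0%N (X \o dyadic n) w].
have mB a n : measurable (B a n).
  rewrite -[X in measurable X]setTI; apply: emeasurable_fun_o_infty => //.
  apply: measurable_process_sup_discrete => k.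
  by have [[_ aX _] _ _] := tXn n; exact: measurable_int (aX k _).2.
have ndB a : nondecreasing_seq (B a).
  move=> m n mn; apply/subsetPset => w /= /lt_le_trans; apply.
  exact: dyadic_process_sup_nondecreasing.
have mUB a : measurable (\bigcup_n B a n) by exact: bigcup_measurable.
have mNS (S : set T) : measurable (N `&` S).
  by apply: complete; exists N; split => // w [].
have SE a : [set w | a%:E < process_sup 0%R X w] =
    \bigcup_n B a n `|` (N `&` [set w | a%:E < process_sup 0%R X w]).
  apply/seteqP; split => w /=; last first.
    by move=> [[n _ /= /lt_le_trans]|[]//]; apply; exact: process_sup_ge_dyadic.
  have [Nw|Nw] := pselect (N w); first by move=> aS; right.
  move=> aS; left; have [|n Bn] := process_sup_continuous_gt _ aS; last by exists n.
  by apply: contrapT => nX; apply: Nw; apply: NX.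
apply: p_test_inve => [w||a a1]; first exact: process_sup_ge1.
- by apply: measurable_fun_gt => a; rewrite SE; exact: measurableU.
rewrite SE (le_trans (measureU2 _ _ _))//.
rewrite [X in _ + X](_ : _ = 0) ?adde0; last first.
  by apply: (subset_measure0 _ _ _ PN) => // w [].
apply: nondecreasing_measure_bigcup_le => // n.
exact: discrete_process_sup_tail (tXn n) a1.
Qed.

End tail_bounds.

(** * A martingale with a prescribed supremum *)

Section wealth.
Context d (T : measurableType d) (R : realType) (P : probability T R).
Variable p : T -> \bar R.
Hypothesis pP : precise_p_test P p.

(** The inequality is strict so that the paths of the wealth are
right-continuous.  The time t in [0, +oo[ stands for the level 1 + t: no level
is the last one, as it must be for the wealth to keep mean 1 although almost
every path ends at 0. *)
Definition alive (t : R) : set T := [set w | p w < ((1 + t)^-1)%:E].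

Definition wealth (t : R) (w : T) : \bar R := ((1 + t) * \1_(alive t) w)%:E.

Let mp : measurable_fun [set: T] p.
Proof. by case: pP => -[]. Qed.

Lemma measurable_alive t : measurable (alive t).
Proof. by rewrite -[X in measurable X]setTI; exact: emeasurable_fun_infty_o. Qed.

Lemma alive_anti s t : (0 <= s)%R -> (s <= t)%R -> alive t `<=` alive s.
Proof.
move=> s0 st w /lt_le_trans; apply; rewrite lee_fin lef_pV2 ?posrE ?lerD2l//.
- by rewrite ltr_wpDr// (le_trans s0).
- by rewrite ltr_wpDr.
Qed.

Lemma wealth_ge0 t : (0 <= t)%R -> forall w, 0 <= wealth t w.
Proof. by move=> t0 w; rewrite lee_fin mulr_ge0// addr_ge0. Qed.

Lemma measurable_wealth t : measurable_fun [set: T] (wealth t).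
Proof.
apply/measurable_EFinP; apply: measurable_funM => //.
exact: (measurable_indic (measurable_alive t)).
Qed.

(** A precise p-test has no atoms in ]0, 1]: the probability of p < c is squeezed
between those of p <= c - e and p <= c. *)
Lemma precise_p_test_prob_lt (c : R) : (0 < c <= 1)%R ->
  P [set w | p w < c%:E] = c%:E.
Proof.
move=> /andP[c0 c1]; have [_ pE] := pP.
have mlt : measurable [set w | p w < c%:E].
  by rewrite -[X in measurable X]setTI; exact: emeasurable_fun_infty_o.
have mle (b : R) : measurable [set w | p w <= b%:E].
  by rewrite -[X in measurable X]setTI; exact: emeasurable_fun_infty_c.
apply/eqP; rewrite eq_le; apply/andP; split.
  rewrite -[leRHS]pE ?(ltW c0)//; apply: le_measure; rewrite ?inE//.
  by move=> w /ltW.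
apply/lee_addgt0Pr => e e0.
have [ce|ce] := leP c e.
  by rewrite -[leLHS]add0e leeD// lee_fin.
rewrite -leeBlDr// -EFinB -[leLHS]pE; last first.
  by rewrite subr_ge0 ltW//= (le_trans _ c1)// gerBl ltW.
apply: le_measure; rewrite ?inE// => w /= /le_lt_trans; apply.
by rewrite lte_fin gtrBl.
Qed.

Lemma integral_wealth t (A : set T) : (0 <= t)%R -> measurable A ->
  \int[P]_(w in A) wealth t w = (1 + t)%:E * P (alive t `&` A).
Proof.
move=> t0 mA; have t1 : (0 <= 1 + t)%R by rewrite addr_ge0.
rewrite /wealth; under eq_integral do rewrite EFinM.
have mt := measurable_alive t.
by rewrite ge0_integralZl ?integral_indic//; exact/measurable_EFinP/measurable_indic.
Qed.

Lemma expected_wealth t : (0 <= t)%R -> (1 + t)%:E * P (alive t) = 1.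
Proof.
move=> t0; have t1 : (0 < 1 + t)%R by rewrite ltr_pwDl.
rewrite precise_p_test_prob_lt ?invr_gt0 ?t1 ?invf_le1 ?lerDl// -EFinM divff ?gt_eqF//.
Qed.

(** The sets that contain [alive s] or miss it form a sigma-algebra, and it
contains the generators because every wealth r with r <= s is constant, equal to
1 + r, on [alive s]. *)
Lemma alive_atom s A : (0 <= s)%R -> natural_filtration 0%R wealth s A ->
  alive s `<=` A \/ alive s `<=` ~` A.
Proof.
move=> s0; pose C := [set A : set T | alive s `<=` A \/ alive s `<=` ~` A].
suff : natural_filtration 0%R wealth s `<=` C by move=> H /H.
apply: smallest_sub.
  split => [|B [sB|sB]|B sB].
  - by right; rewrite setC0.
  - by right; rewrite setTD setCK.
  - by left; rewrite setTD.
  - have [[n sBn]|nB] := pselect (exists n, alive s `<=` B n).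
      by left; apply: subset_trans sBn _; exact: bigcup_sup.
    right; rewrite setC_bigcup => w sw n _.
    by have [sBn|] := sB n; [case: nB; exists n|exact].
move=> _ [r /= /andP[r0 rs] [B _ <-]].
have wealthr w : alive s w -> wealth r w = (1 + r)%:E.
  by move=> /(alive_anti r0 rs) rw; rewrite /wealth indicE mem_set// mulr1.
have [Br|Br] := pselect (B (1 + r)%:E); [left|right] => w /wealthr /= Ew.
  by split => //=; rewrite /preimage/= Ew.
by move=> [_]; rewrite /preimage/= Ew.
Qed.

(** The wealth at times s and t vanishes off [alive s].  Hence both integrals are
full means, equal to 1, if A contains [alive s], and are 0 if A misses it. *)
Lemma wealth_conserved s t A : (0 <= s)%R -> (s <= t)%R -> measurable A ->
  alive s `<=` A \/ alive s `<=` ~` A ->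
  \int[P]_(w in A) wealth t w = \int[P]_(w in A) wealth s w.
Proof.
move=> s0 st mA; have t0 := le_trans s0 st; rewrite !integral_wealth//.
have ts := alive_anti s0 st.
move=> [sA|sA].
  by rewrite (setIidl sA) (setIidl (subset_trans ts sA)) !expected_wealth.
have sA0 : alive s `&` A = set0.
  by apply/seteqP; split => // w [/sA].
rewrite sA0 (_ : alive t `&` A = set0) ?measure0 ?mule0//.
by apply/seteqP; split => // w [/ts/sA].
Qed.

Lemma natural_filtration_wealth :
  is_filtration 0%R (natural_filtration 0%R wealth).
Proof.
split => [t t0|s t s0 st].
  split; first exact: smallest_sigma_algebra.
  apply: smallest_sub; first exact: sigma_algebra_measurable.
  move=> _ [r /= /andP[r0 _] [B mB <-]].
  exact: measurable_wealth.
apply: sub_sigma_algebra2 => A [r /= /andP[r0 rs] rA].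
by exists r => //=; rewrite r0/= (le_trans rs)// ltW.
Qed.

Lemma wealth_adapted_integrable :
  adapted_integrable 0%R P wealth (natural_filtration 0%R wealth).
Proof.
move=> t t0; split.
  by apply: sub_smallest => A tA; exists t => //=; rewrite t0 lexx.
apply/integrableP; split; first exact: measurable_wealth.
under eq_integral do rewrite gee0_abs ?wealth_ge0//.
by rewrite integral_wealth// setIT expected_wealth// ltry.
Qed.

Lemma wealth_martingale :
  martingale 0%R P wealth (natural_filtration 0%R wealth).
Proof.
have fF := natural_filtration_wealth; have aF := wealth_adapted_integrable.
split => // s t s0 st; exists (wealth s); last exact: nearW.
have [? ?] := aF _ s0; split => // A sA.
apply/esym/wealth_conserved => //; first exact: ltW.
- exact: (fF.1 _ s0).2.
- exact: alive_atom.
Qed.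

(** The event [alive t] is defined by a strict inequality, hence persists for a
while after t, and once lost it is lost for good. *)
Lemma wealth_right_continuous w t : (0 <= t)%R -> wealth^~ w @ t^'+ --> wealth t w.
Proof.
move=> t0; have [tw|tw] := pselect (alive t w); last first.
  have wealth0 s : (t <= s)%R -> wealth s w = 0.
    move=> ts; rewrite /wealth indicE memNset ?mulr0//.
    by move=> /(alive_anti t0 ts).
  rewrite wealth0//; apply: cvg_near_cst; near=> s.
  by apply: wealth0; near: s; exact: nbhs_right_ge.
have wealthE s : alive s w -> wealth s w = (1 + s)%:E.
  by move=> sw; rewrite /wealth indicE mem_set// mulr1.
have cD : (1 + s)%R @[s --> t^'+] --> (1 + t)%R.
  by apply: cvg_at_right_filter; apply: cvgD; [exact: cvg_cst|exact: cvg_id].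
have near_alive : \forall s \near t^'+, alive s w.
  have t1 : (1 + t)%R != 0%R by rewrite gt_eqF// ltr_pwDl.
  have cV : ((1 + s)^-1)%R @[s --> t^'+] --> ((1 + t)^-1)%R by exact: cvgV.
  apply: (cV [set y | p w < y%:E]).
  by apply: open_nbhs_nbhs; split; [exact: open_ereal_gt|].
rewrite wealthE//; apply: (@cvg_trans _ ((1 + s)%:E @[s --> t^'+])).
  by apply: near_eq_cvg; near=> s; apply/esym/wealthE; near: s.
by apply: cvg_EFin; [exact: nearW|].
Unshelve. all: by end_near. Qed.

(** The path equals 1 + t exactly while 1 + t < 1 / p, so it takes every value in
[1, 1 / p[.  When p = 1 the wealth is never positive, and the supremum is the
value 1 given to the times before 0; when p = 0 the wealth is never lost. *)
Lemma process_sup_wealth w : process_sup 0%R wealth w = (p w)^-1.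
Proof.
have [[_ p01 _] _] := pP; have /andP[p0 p1] := p01 w.
apply/eqP; rewrite eq_le; apply/andP; split.
  rewrite /process_sup ge_max inve_ge1// p1/=.
  apply: ge_ereal_sup => _ [t /= t0 <-].
  have t1 : (0 < 1 + t)%R by rewrite ltr_pwDl.
  rewrite /wealth indicE; have [|_] := boolP (w \in _); last first.
    by rewrite mulr0 inve_ge0.
  rewrite inE => tw; rewrite mulr1 inve_pge ?inE ?lee_fin ?(ltW t1)//.
  by rewrite inver gt_eqF// ltW.
rewrite leNgt; apply/negP => Sp.
(* A value u strictly between them is the wealth at time u - 1. *)
have [u /andP[Su up]] : exists u : R, process_sup 0%R wealth w < u%:E < (p w)^-1.
  have := process_sup_ge1 0%R wealth w.
  move: Sp; case: (process_sup _ _ _) => [r| |]//; last by case: ((p w)^-1).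
  case: ((p w)^-1) => [q| |]// rq r1.
    by rewrite lte_fin in rq; exists ((r + q) / 2)%R; rewrite !lte_fin !(midf_lt rq).
  by exists (r + 1)%R; rewrite ltry lte_fin ltrDl ltr01.
have u1 : (1 < u)%R.
  by rewrite -lte_fin; apply: le_lt_trans Su; exact: process_sup_ge1.
have := @process_sup_ge _ T R _ _ 0%R wealth (u - 1)%R w.
rewrite subr_ge0 (ltW u1) => /(_ isT); apply/negP; rewrite -ltNge.
rewrite /wealth indicE mem_set/=; last first.
  rewrite /alive/= addrC subrK.
  have -> : (u^-1)%:E = u%:E^-1 by rewrite inver gt_eqF// (lt_trans _ u1).
  by rewrite -inve_pgt// inE lee_fin (le_trans _ (ltW u1)).
by rewrite mulr1 addrC subrK.
Qed.

Lemma precise_p_test_test_martingale :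
  test_martingale_continuous P wealth /\
  forall w, p w = 1 / process_sup 0%R wealth w.
Proof.
split; last by move=> w; rewrite mul1e process_sup_wealth inveK.
split.
- by apply: nearW => w t; exact: wealth_right_continuous.
- exact: wealth_martingale.
- by move=> t t0 w; exact: wealth_ge0.
- by rewrite integral_wealth// setIT expected_wealth.
Qed.

End wealth.

Theorem theorem2 (R : realType) (d : measure_display) (Omega : measurableType d)
    (P : probability Omega R) :
  (* (1), discrete and continuous time *)
  ((forall (X : nat -> Omega -> \bar R) (F : nat -> set (set Omega)),
      test_supermartingale_discrete P X F ->
      p_test P (fun w => 1 / process_sup 0%N X w)) /\
   (forall (X : R -> Omega -> \bar R) (F : R -> set (set Omega)),
      test_supermartingale_continuous P X F ->
      p_test P (fun w => 1 / process_sup 0%R X w))) /\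
  (* (2) *)
  (forall p : Omega -> \bar R, precise_p_test P p ->
     (exists X : nat -> Omega -> \bar R,
        test_martingale_discrete P X /\
        forall w, p w = 1 / process_sup 0%N X w) \/
     (exists X : R -> Omega -> \bar R,
        test_martingale_continuous P X /\
        forall w, p w = 1 / process_sup 0%R X w)).
Proof.
split; first by split => X F; [exact: p_test_discrete|exact: p_test_continuous].
move=> p pP; right; exists (wealth p); exact: precise_p_test_test_martingale.
Qed.
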